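(* For any integer $d\ge 1$ and any complex numbers $z_0, z_1,\ldots, z_d$ with $|z_j|<1$, $j=0,1,\ldots,d$, we have $$\sum_{a_0,\ldots,a_d\ge 0}\zeta^{\star}(\{2\}^{a_0},3,\{2\}^{a_1},\ldots,3,\{2\}^{a_d})\,z_0^{2a_0}\cdots z_d^{2a_d}=-2\sum_{k_0\ge\cdots\ge k_d\ge 1}\frac{(-1)^{k_0}k_d^2}{k_0^2-z_0^2}\,\prod_{i=1}^d\frac{2^{\Delta(k_{i-1},k_i)}}{k_i(k_i^2-z_i^2)},$$ where the argument of $\zeta^\star$ contains exactly $d$ entries equal to $3$. In particular (the case of a single variable), for any complex $z_0$ with $|z_0|<1$, $$\sum_{a_0\ge 0}\zeta^\star(\{2\}^{a_0})\,z_0^{2a_0}=1-2z_0^2\sum_{k_0\ge 1}\frac{(-1)^{k_0}}{k_0^2-z_0^2}.$$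
   Context: For positive integers $s_1,\ldots,s_m$ with $s_1\ge 2$, the multiple zeta star value is $\zeta^\star(s_1,\ldots,s_m)=\sum_{k_1\ge\cdots\ge k_m\ge 1}\frac{1}{k_1^{s_1}\cdots k_m^{s_m}}$ (sum over positive integers), and $\zeta^\star(\emptyset)=1$. $\{2\}^a$ denotes the sequence consisting of $a$ copies of $2$ (empty if $a=0$). $\Delta(a,b)=0$ if $a=b$ and $\Delta(a,b)=1$ otherwise. In all sums the indices $a_i,k_i$ are integers, and $0^0=1$ in power series. *)

(* Defs.v *)
From HB Require Import structures.
From mathcomp Require Import all_boot all_order all_algebra finmap.
From mathcomp Require Import complex.
From mathcomp Require Import all_classical all_reals all_analysis.
From mathcomp.analysis.showcase Require Import summability.
Set Implicit Arguments.
Unset Strict Implicit.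
Unset Printing Implicit Defensive.
Import Order.TTheory GRing.Theory Num.Theory.
Import numFieldNormedType.Exports.
Local Open Scope classical_set_scope.
Local Open Scope ring_scope.
Local Open Scope complex_scope.

(* A multiple series is read as an unconditionally convergent family: its
   partial sums over finite sets of indices converge along inclusion.  Over
   the complex numbers this is the same as absolute convergence. *)
Definition has_sum (K : numFieldType) (I : choiceType) (D : set I)
    (f : I -> K) (s : K) : Prop :=
  partial_sum (fun i => if i \in D then f i else 0) @ totally --> s.

Definition noninc_pos (n : nat) : set {ffun 'I_n -> nat} :=
  [set k | (forall i, (1 <= k i)%N) /\
           (forall i j : 'I_n, (i <= j)%N -> (k j <= k i)%N)].
Arguments noninc_pos n _ : clear implicits.

(* The terms are nonnegative, so the sum always exists in [0, +oo]; it is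
   finite when s is empty or its first entry is at least 2 (other entries
   being positive), and [fine] is used only there. *)
Definition zeta_star (R : realType) (s : seq nat) : R :=
  fine (\esum_(k in noninc_pos (size s))
    (\prod_(i < size s) ((k i)%:R ^+ nth 0%N s i)^-1)%:E).

(* {2}^{a_0}, 3, {2}^{a_1}, ..., 3, {2}^{a_d} *)
Definition index23 (d : nat) (a : {ffun 'I_d.+1 -> nat}) : seq nat :=
  nseq (a ord0) 2%N ++
  flatten [seq 3%N :: nseq (a (lift ord0 i)) 2%N | i <- enum 'I_d].

Definition Delta (a b : nat) : nat := if a == b then 0%N else 1%N.

Definition lhs_term (R : realType) (d : nat) (z : 'I_d.+1 -> R[i])
    (a : {ffun 'I_d.+1 -> nat}) : R[i] :=
  (zeta_star R (index23 a))%:C * \prod_(j < d.+1) z j ^+ (2 * a j).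

(* For i : 'I_d, the index i + 1 of the product runs over 1, ..., d:
   lift ord0 i has value i + 1 and widen_ord _ i has value i. *)
Definition rhs_term (R : realType) (d : nat) (z : 'I_d.+1 -> R[i])
    (k : {ffun 'I_d.+1 -> nat}) : R[i] :=
  (-1) ^+ k ord0 * (k ord_max)%:R ^+ 2 / ((k ord0)%:R ^+ 2 - z ord0 ^+ 2) *
  \prod_(i < d)
    (2 ^+ Delta (k (widen_ord (leqnSn d) i)) (k (lift ord0 i)) /
     ((k (lift ord0 i))%:R *
      ((k (lift ord0 i))%:R ^+ 2 - z (lift ord0 i) ^+ 2))).

(* Main.v *)
Require Import Defs.
From HB Require Import structures.
From mathcomp Require Import all_boot all_order all_algebra finmap.
From mathcomp Require Import complex ring lra zify.
From mathcomp Require Import all_classical all_reals all_analysis.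
From mathcomp.analysis.showcase Require Import summability.

(** The idea is to truncate both sides at an integer [n], to check that the two
    truncations are equal because they obey the same recursion in [n], and to
    let [n] tend to infinity.

    On the left, bound the outermost summation index of each zeta star value by
    [n] and call F_n(z_0,...,z_d) the resulting generating function.  Separating
    the terms with outermost index [n] according to whether the first entry of
    the argument is a 2 or a 3 gives, for d >= 1,

      F_n(z_0,...,z_d) = F_(n-1)(z_0,...,z_d) + z_0^2/n^2 F_n(z_0,...,z_d)
                         + 1/n^3 F_n(z_1,...,z_d),

    and the same without the last summand for d = 0.

    On the right, insert into the summand the factor
    w_n(k_0) = C(2n, n+k_0)/C(2n, n), which vanishes for k_0 > n, and call the
    resulting finite sum G_n.  As w_(n-1)(k) = w_n(k) (n^2 - k^2)/n^2, the
    difference (1 - z_0^2/n^2) G_n - G_(n-1) loses the denominator k_0^2 - z_0^2.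
    In it k_0 occurs, for fixed k_1, only through the sum of (-1)^(k_0) w_n(k_0)
    over k_0 >= k_1, with weight 2 when k_0 > k_1.  That sum telescopes
    ([bin_ratio_tail]) to k_1/n (-1)^(k_1) w_n(k_1), and the factor k_1 cancels
    the factor 1/k_1 of the summand, so that the recursion of F_n appears
    ([finite_rhs_rec]).  For d = 0 the whole alternating sum of the w_n(k) is
    -1/2, which accounts for the constant 1 ([finite_rhs0_rec]).  Hence F_n = G_n
    ([sums_to_trunc_lhs], [sums_to_trunc_lhs_dim1]).

    The limit is taken twice by dominated convergence for unconditional sums
    ([sums_to_tannery]).  On the left, every truncated zeta star value whose
    entries are at least 2 is bounded by 2 ([trunc_zeta_le2]), so the terms are
    dominated by a product of geometric series.  On the right, w_n(k) lies in
    [0, 1] and tends to 1, and the summand is dominated by a constant times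
    1/(k_0^2 k_1 ... k_d), whose sum over k_0 >= ... >= k_d >= 1 is finite
    ([trunc_zeta_two_ones_le]). *)

Set Implicit Arguments.
Unset Strict Implicit.
Unset Printing Implicit Defensive.
Import Order.TTheory GRing.Theory Num.Theory.
Import numFieldNormedType.Exports.
Local Open Scope classical_set_scope.
Local Open Scope ring_scope.
Local Open Scope complex_scope.
#[local] Existing Instance totally_filter.

(** * Unconditional sums *)

Definition sums_to (K : numFieldType) (I : choiceType) (f : I -> K) (s : K) :=
  partial_sum f @ totally --> s.

Lemma has_sumE (K : numFieldType) (I : choiceType) (D : set I) (f : I -> K) s :
  has_sum D f s = sums_to (fun i => if i \in D then f i else 0) s.
Proof. by []. Qed.

Lemma has_sum_setT (K : numFieldType) (I : choiceType) (f : I -> K) s :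
  has_sum [set: I] f s = sums_to f s.
Proof.
by rewrite has_sumE; congr sums_to; apply/funext => i; rewrite in_setT.
Qed.

Lemma partial_sumE (K : zmodType) (I : choiceType) (f : I -> K) (A : {fset I}) :
  partial_sum f A = \sum_(i <- A) f i.
Proof. by rewrite /partial_sum big_seq_fsetE. Qed.

Lemma sums_toP (K : numFieldType) (I : choiceType) (f : I -> K) s :
  sums_to f s <->
  forall e, 0 < e -> exists A : {fset I}, forall B, (A `<=` B)%fset ->
    `|s - \sum_(i <- B) f i| < e.
Proof.
split=> [/cvgrPdist_lt h e /h [A _ AP]|h].
  by exists A => B /AP; rewrite partial_sumE.
apply/cvgrPdist_lt => e /h [A AP]; exists A => // B /AP.
by rewrite /= partial_sumE.
Qed.

Lemma sums_to_unique (K : numFieldType) (I : choiceType) (f : I -> K) s t :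
  sums_to f s -> sums_to f t -> s = t.
Proof. exact: cvg_unique. Qed.

Lemma sums_toD (K : numFieldType) (I : choiceType) (f g : I -> K) s t :
  sums_to f s -> sums_to g t -> sums_to (fun i => f i + g i) (s + t).
Proof.
move=> fs gt; rewrite /sums_to.
rewrite (_ : partial_sum _ = partial_sum f \+ partial_sum g); first exact: cvgD.
by apply/funext => A; rewrite !partial_sumE big_split /= !partial_sumE.
Qed.

Lemma sums_toZ (K : numFieldType) (I : choiceType) (f : I -> K) c s :
  sums_to f s -> sums_to (fun i => c * f i) (c * s).
Proof.
move=> fs; rewrite /sums_to.
rewrite (_ : partial_sum _ = (fun A => c * partial_sum f A));
  first by apply: cvgM => //; exact: cvg_cst.
by apply/funext => A; rewrite !partial_sumE mulr_sumr.
Qed.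

Lemma sum_fset_subset (V : nmodType) (I : choiceType) (A B : {fset I})
    (f : I -> V) : (A `<=` B)%fset ->
  \sum_(i <- B) f i = \sum_(i <- A) f i + \sum_(i <- B | i \notin A) f i.
Proof.
move=> AB; rewrite (big_fsetID _ (mem A) B) /= (big_fset_condE _ B).
rewrite (_ : [fset x in B | x \in A]%fset = A) //.
by apply/fsetP => i; rewrite !inE /= andbC; apply/andb_idr/(fsubsetP AB).
Qed.

Lemma sums_to_finite (K : numFieldType) (I : choiceType) (f : I -> K)
    (A : {fset I}) :
  (forall i, i \notin A -> f i = 0) -> sums_to f (\sum_(i <- A) f i).
Proof.
move=> f0; apply/sums_toP => e e0; exists A => B AB.
by rewrite (big_fset_incl _ AB) ?subrr ?normr0// => i _ /f0.
Qed.

Lemma sums_to0 (K : numFieldType) (I : choiceType) :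
  sums_to (fun=> 0 : K) (0 : K) (I := I).
Proof.
by have := @sums_to_finite K I (fun=> 0) fset0 (fun _ _ => erefl); rewrite big1.
Qed.

(** Transport along an injection [e] with a given left inverse [p]; the test
    [e (p j) == j] decides membership in the range of [e]. *)
Lemma sums_to_reindex (K : numFieldType) (I J : choiceType) (e : I -> J)
    (p : J -> I) (f : I -> K) s :
  cancel e p -> sums_to f s ->
  sums_to (fun j => if e (p j) == j then f (p j) else 0) s.
Proof.
move=> eK /sums_toP fs; apply/sums_toP => eps /fs [A AP].
exists (e @` A)%fset => B AB.
rewrite -big_mkcond /=.
have -> : \sum_(j <- B | e (p j) == j) f (p j) =
    \sum_(i <- (p @` [fset j in B | e (p j) == j])%fset) f i.
  rewrite big_imfset /=; first by rewrite big_fset.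
  by move=> x y; rewrite !inE /= => /andP[_ /eqP xE] /andP[_ /eqP yE] pxy;
     rewrite -xE -yE pxy.
apply: AP; apply/fsubsetP => i iA; apply/imfsetP; exists (e i) => //=.
rewrite !inE /= eK eqxx andbT; apply: (fsubsetP AB).
by apply/imfsetP; exists i.
Qed.

(** Naming the limit over an abstract [numFieldType] fixes the topology once, so
    that instances at [R[i]] do not depend on how it is inferred there. *)
Definition tends_to (K : numFieldType) (u : nat -> K) (l : K) :=
  u @ \oo --> l.

Lemma tends_toP (K : numFieldType) (u : nat -> K) l :
  tends_to u l <->
  forall e, 0 < e -> exists N, forall n, (N <= n)%N -> `|l - u n| < e.
Proof.
split=> [/cvgrPdist_lt h e /h [N _ NP]|h]; first by exists N.
by apply/cvgrPdist_lt => e /h [N NP]; exists N.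
Qed.

Lemma tends_to_unique (K : numFieldType) (u : nat -> K) l m :
  tends_to u l -> tends_to u m -> l = m.
Proof. exact: cvg_unique. Qed.

Lemma tends_to_cst (K : numFieldType) (c : K) : tends_to (fun=> c) c.
Proof. exact: cvg_cst. Qed.

Lemma tends_toD (K : numFieldType) (u v : nat -> K) l m :
  tends_to u l -> tends_to v m -> tends_to (fun n => u n + v n) (l + m).
Proof. exact: cvgD. Qed.

Lemma tends_toM (K : numFieldType) (u v : nat -> K) l m :
  tends_to u l -> tends_to v m -> tends_to (fun n => u n * v n) (l * m).
Proof. exact: cvgM. Qed.

Lemma tends_to_sum (K : numFieldType) (I : Type) (r : seq I)
    (u : I -> nat -> K) (l : I -> K) :
  (forall i, tends_to (u i) (l i)) ->
  tends_to (fun n => \sum_(i <- r) u i n) (\sum_(i <- r) l i).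
Proof.
move=> ul; elim: r => [|i r IHr].
  by under eq_fun do rewrite big_nil; rewrite big_nil; apply: tends_to_cst.
by under eq_fun do rewrite big_cons; rewrite big_cons; apply: tends_toD.
Qed.

Definition bounded_sums (R : realType) (I : choiceType) (b : I -> R) :=
  exists M, forall A : {fset I}, \sum_(i <- A) b i <= M.

Section RealSums.
Variables (R : realType) (I : choiceType).
Implicit Types (b f : I -> R).

(** The set [A] is one whose sum is within [e] of the supremum of all finite
    sums; any larger set gains less than [e]. *)
Lemma bounded_sums_tail b : (forall i, 0 <= b i) -> bounded_sums b ->
  forall e, 0 < e -> exists A : {fset I}, forall B : {fset I},
    (A `<=` B)%fset -> \sum_(i <- B | i \notin A) b i < e.
Proof.
move=> b0 [M bM] e e0.
pose S := [set \sum_(i <- A) b i | A in [set: {fset I}]].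
have supS : has_sup S.
  split; first by exists (\sum_(i <- fset0) b i), fset0.
  by exists M => _ [A _ <-].
have [_ [A _ <-] hA] := sup_adherent e0 supS.
exists A => B AB.
have : \sum_(i <- B) b i <= sup S by apply: ub_le_sup; [case: supS|exists B].
rewrite (sum_fset_subset _ AB); lra.
Qed.

Lemma sums_to_bounded_ge0 b : (forall i, 0 <= b i) -> bounded_sums b ->
  exists s, sums_to b s.
Proof.
move=> b0 [M bM].
pose S := [set \sum_(i <- A) b i | A in [set: {fset I}]].
have supS : has_sup S.
  split; first by exists (\sum_(i <- fset0) b i), fset0.
  by exists M => _ [A _ <-].
exists (sup S); apply/sums_toP => e e0.
have [_ [A _ <-] hA] := sup_adherent e0 supS.
exists A => B AB.
have BS : \sum_(i <- B) b i <= sup S.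
  by apply: ub_le_sup; [case: supS|exists B].
have : \sum_(i <- A) b i <= \sum_(i <- B) b i.
  by rewrite (sum_fset_subset _ AB) lerDl; apply: sumr_ge0.
move=> AB'; rewrite ger0_norm; lra.
Qed.

(** [f] is the difference of the families [f + b] and [b], which are nonnegative
    and have bounded finite sums. *)
Lemma sums_to_dominated_real b f : bounded_sums b ->
  (forall i, `|f i| <= b i) -> exists s, sums_to f s.
Proof.
move=> [M bM] fb.
have b0 i : 0 <= b i by apply: le_trans (fb i).
have [t bt] := sums_to_bounded_ge0 b0 (ex_intro _ M bM).
have [] := @sums_to_bounded_ge0 (fun i => f i + b i).
- by move=> i; have := fb i; rewrite ler_norml => /andP[]; lra.
- exists (M + M) => A; rewrite big_split /= lerD ?bM//.
  apply: le_trans (bM A); apply: ler_sum => i _.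
  by apply: le_trans (fb i); rewrite ler_norm.
move=> s fs; exists (s + -1 * t).
rewrite (_ : f = fun i => f i + b i + -1 * b i).
  by apply: sums_toD => //; apply: sums_toZ.
by apply/funext => i; ring.
Qed.

End RealSums.

Section ComplexSums.
Variables (R : realType) (I : choiceType).
Implicit Types (b : I -> R) (f : I -> R[i]).

Lemma gt0_real_complex (e : R[i]) : 0 < e -> exists2 r : R, 0 < r & e = r%:C.
Proof.
by case: e => a c; rewrite ltcE /= => /andP[/eqP -> a0]; exists a.
Qed.

Lemma real_complex_gt0 (r : R) : (0 < r%:C) = (0 < r).
Proof. by rewrite -[X in X < _]/(0%:C) ltcR. Qed.

Lemma normc_real (x : R) : `|x%:C| = `|x|%:C.
Proof. by rewrite normc_def /= expr0n addr0 sqrtr_sqr. Qed.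

Lemma sums_to_real_complex (b : I -> R) s :
  sums_to b s -> sums_to (fun i => (b i)%:C) s%:C.
Proof.
move=> /sums_toP bs; apply/sums_toP => e /gt0_real_complex[r r0 ->].
have [A AP] := bs _ r0; exists A => B /AP.
by rewrite -rmorph_sum -rmorphB normc_real ltcR.
Qed.

(** Completeness is used on the real and imaginary parts separately. *)
Lemma sums_to_dominated b f : bounded_sums b ->
  (forall i, `|f i| <= (b i)%:C) -> exists s, sums_to f s.
Proof.
move=> bM fb.
have [|s fs] := @sums_to_dominated_real _ _ b (fun i => complex.Re (f i)) bM.
  move=> i; rewrite -lecR; apply: le_trans (fb i); exact: normc_ge_Re.
have [|t ft] := @sums_to_dominated_real _ _ b (fun i => complex.Im (f i)) bM.
  move=> i; rewrite -lecR; apply: le_trans (fb i); rewrite normc_def lecR.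
  by rewrite -sqrtr_sqr ler_wsqrtr // lerDr sqr_ge0.
exists (s%:C + 'i * t%:C).
rewrite (_ : f = fun i => (complex.Re (f i))%:C + 'i * (complex.Im (f i))%:C).
  by apply: sums_toD; [|apply: sums_toZ]; apply: sums_to_real_complex.
by apply/funext => i; rewrite {1}[f i]complexE.
Qed.

Lemma sums_to_tail b f s (A : {fset I}) (e : R) :
  (forall i, `|f i| <= (b i)%:C) ->
  (forall B : {fset I}, (A `<=` B)%fset -> \sum_(i <- B | i \notin A) b i < e) ->
  0 < e -> sums_to f s -> `|s - \sum_(i <- A) f i| <= (e + e)%:C.
Proof.
move=> fb bA e0 /sums_toP /(_ e%:C); rewrite real_complex_gt0.
move=> /(_ e0) [B] /(_ (A `|` B)%fset).
rewrite fsubsetUr => /(_ isT) h.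
have -> : s - \sum_(i <- A) f i = (s - \sum_(i <- (A `|` B)%fset) f i) +
   \sum_(i <- (A `|` B)%fset | i \notin A) f i.
  by rewrite (sum_fset_subset _ (fsubsetUl A B)); ring.
rewrite rmorphD; apply: (le_trans (ler_normD _ _)); apply: lerD; first exact: ltW.
apply: (le_trans (ler_norm_sum _ _ _)).
have /ltW := bA _ (fsubsetUl A B); rewrite -lecR rmorph_sum; apply: le_trans.
by apply: ler_sum => i _; apply: fb.
Qed.

(** Tannery's theorem, i.e. dominated convergence for unconditional sums: outside
    a finite set depending only on the majorant all the sums are small, and on
    that set pointwise convergence suffices. *)
Lemma sums_to_tannery b (f : nat -> I -> R[i]) g (s : nat -> R[i]) :
  (forall i, 0 <= b i) -> bounded_sums b ->
  (forall n i, `|f n i| <= (b i)%:C) ->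
  (forall i, tends_to (f ^~ i) (g i)) ->
  (forall n, sums_to (f n) (s n)) -> exists2 t, sums_to g t & tends_to s t.
Proof.
move=> b0 bM fb fg fs.
have gb i : `|g i| <= (b i)%:C.
  apply/ler_addgt0Pl => e e0.
  have /tends_toP/(_ e e0)[n /(_ n (leqnn n)) h] := fg i.
  rewrite -[g i](subrK (f n i)); apply: (le_trans (ler_normD _ _)).
  by apply: lerD (fb n i); apply: ltW.
have [t gt] := sums_to_dominated bM gb; exists t => //.
apply/tends_toP => _ /gt0_real_complex[e e0 ->].
(* Two errors outside [A] of size at most 2e/5 each, and one on [A] below e/5. *)
have e5 : 0 < e / 5 by rewrite divr_gt0.
have [A AP] := bounded_sums_tail b0 bM e5.
have /tends_toP/(_ (e / 5)%:C) := tends_to_sum (r := A) fg.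
rewrite real_complex_gt0 => /(_ e5)[N NP]; exists N => n /NP h.
have h1 := sums_to_tail gb AP e5 gt.
have h2 := sums_to_tail (fb n) AP e5 (fs n).
have -> : t - s n = (t - \sum_(i <- A) g i) +
   (\sum_(i <- A) g i - \sum_(i <- A) f n i) - (s n - \sum_(i <- A) f n i) by ring.
apply: (le_lt_trans (ler_normB _ _)).
apply: (le_lt_trans (lerD (ler_normD _ _) h2)).
have -> : e%:C = (e / 5 + e / 5)%:C + (e / 5)%:C + (e / 5 + e / 5)%:C.
  by rewrite -!rmorphD /=; congr (_%:C); field.
by rewrite ltrD2r; apply: ler_ltD.
Qed.

End ComplexSums.

Lemma tends_to_real_complex (R : realType) (u : nat -> R) l :
  tends_to u l -> tends_to (fun n => (u n)%:C) l%:C.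
Proof.
move=> /tends_toP ul; apply/tends_toP => _ /gt0_real_complex[r r0 ->].
have [N NP] := ul _ r0; exists N => n /NP.
by rewrite -rmorphB normc_real ltcR.
Qed.
(** * Weakly decreasing tuples of positive integers *)

Definition cons_ffun d (k : nat) (f : {ffun 'I_d -> nat}) : {ffun 'I_d.+1 -> nat} :=
  [ffun i => oapp f k (unlift ord0 i)].

Definition tail_ffun d (f : {ffun 'I_d.+1 -> nat}) : {ffun 'I_d -> nat} :=
  [ffun i => f (lift ord0 i)].

Lemma cons_ffun0 d k (f : {ffun 'I_d -> nat}) : cons_ffun k f ord0 = k.
Proof. by rewrite ffunE unlift_none. Qed.

Lemma cons_ffunS d k (f : {ffun 'I_d -> nat}) i :
  cons_ffun k f (lift ord0 i) = f i.
Proof. by rewrite ffunE liftK. Qed.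

Lemma cons_ffunK d k : cancel (@cons_ffun d k) (@tail_ffun d).
Proof. by move=> f; apply/ffunP => i; rewrite ffunE cons_ffunS. Qed.

Lemma cons_tail_ffun d (f : {ffun 'I_d.+1 -> nat}) :
  cons_ffun (f ord0) (tail_ffun f) = f.
Proof.
by apply/ffunP => i; rewrite ffunE; case: unliftP => [j|] -> //=; rewrite ffunE.
Qed.

Lemma noninc_pos_cons d k (f : {ffun 'I_d -> nat}) :
  noninc_pos d.+1 (cons_ffun k f) <->
  [/\ (1 <= k)%N, noninc_pos d f & forall i, (f i <= k)%N].
Proof.
split=> [[pos dec]|[k1 [pos dec] fk]].
  split; first by have := pos ord0; rewrite cons_ffun0.
    split=> [i|i j ij]; first by have := pos (lift ord0 i); rewrite cons_ffunS.
    by have := dec (lift ord0 i) (lift ord0 j); rewrite !cons_ffunS; apply.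
  by move=> i; have := dec ord0 (lift ord0 i); rewrite cons_ffun0 cons_ffunS; apply.
split=> [i|i j].
  by case: (unliftP ord0 i) => [i'|] ->; rewrite ?cons_ffunS ?cons_ffun0.
case: (unliftP ord0 i) => [i'|] ->; case: (unliftP ord0 j) => [j'|] ->;
  rewrite ?cons_ffunS ?cons_ffun0 //; exact: dec.
Qed.

(** The elements of [noninc_pos d] bounded by [n], listed by their first
    coordinate so that sums over them unfold into nested sums. *)
Fixpoint chains (n d : nat) : seq {ffun 'I_d -> nat} :=
  match d with
  | 0 => [:: [ffun=> 0%N]]
  | d'.+1 => [seq cons_ffun k f | k <- index_iota 1 n.+1, f <- chains k d']
  end.

Lemma mem_chains n d (f : {ffun 'I_d -> nat}) :
  f \in chains n d <-> noninc_pos d f /\ forall i, (f i <= n)%N.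
Proof.
elim: d n f => [|d IHd] n f /=.
  rewrite inE; split=> _; first by split; [split|]; case.
  by apply/eqP/ffunP; case.
split=> [/allpairsPdep[k [g [+ /IHd[gd gk] ->]]]|].
  rewrite mem_index_iota => /andP[k1 kn].
  split; first exact/noninc_pos_cons.
  move=> i; case: (unliftP ord0 i) => [i'|] ->; rewrite ?cons_ffunS ?cons_ffun0 //.
  exact: leq_trans (gk i') kn.
rewrite -(cons_tail_ffun f) => -[/noninc_pos_cons[k1 gd gk] fn].
apply/allpairsPdep; exists (f ord0), (tail_ffun f); split => //; last exact/IHd.
by rewrite mem_index_iota k1 /=; have := fn ord0; rewrite cons_ffun0.
Qed.

Lemma chains_uniq n d : uniq (chains n d).
Proof.
elim: d n => [|d IHd] n //=.
apply: allpairs_uniq_dep => [|k _|]; [exact: iota_uniq|exact: IHd|].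
move=> [k f] [l g] _ _ /= e.
have kl : k = l.
  by have := congr1 (fun h : {ffun 'I_d.+1 -> nat} => h ord0) e; rewrite !cons_ffun0.
subst l; have := congr1 (@tail_ffun d) e.
by rewrite !cons_ffunK => ->.
Qed.

Lemma sum_chains_cons (V : nmodType) n d (F : {ffun 'I_d.+1 -> nat} -> V) :
  \sum_(f <- chains n d.+1) F f =
  \sum_(1 <= k < n.+1) \sum_(f <- chains k d) F (cons_ffun k f).
Proof. by rewrite /= big_allpairs_dep. Qed.

Lemma mem_fset_seq (I : choiceType) (r : seq I) i :
  (i \in [fset j in r]%fset) = (i \in r).
Proof. by rewrite in_fset. Qed.

Lemma sum_fset_seq (V : nmodType) (I : choiceType) (r : seq I) (F : I -> V) :
  uniq r -> \sum_(i <- [fset i in r]%fset) F i = \sum_(i <- r) F i.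
Proof. by move=> r_uniq; rewrite big_imfset //= undup_id. Qed.

(** A finite family of tuples is bounded, for instance by the sum of all its
    coordinates. *)
Lemma sum_le_chains (R : realType) d (A : {fset {ffun 'I_d -> nat}})
    (g : {ffun 'I_d -> nat} -> R) : (forall f, 0 <= g f) ->
  exists N, \sum_(f <- A | f \in noninc_pos d) g f <= \sum_(f <- chains N d) g f.
Proof.
move=> g0; pose N := (\sum_(f <- A) \sum_i f i)%N; exists N.
rewrite -(sum_fset_seq _ (chains_uniq _ _)) (big_fset_condE _ A).
rewrite [leRHS](@sum_fset_subset _ _ [fset f in A | f \in noninc_pos d]%fset).
  by rewrite lerDl; apply: sumr_ge0.
apply/fsubsetP => f; rewrite !inE /= => /andP[fA /set_mem fd].
apply/mem_chains; split=> // i.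
by rewrite /N (big_fsetD1 f fA) /= (bigD1 i) //= -addnA leq_addr.
Qed.

(** * Truncated zeta star values *)

Fixpoint trunc_zeta (R : realType) (s : seq nat) (n : nat) : R :=
  if s is x :: t then
    \sum_(1 <= m < n.+1) (m%:R ^+ x)^-1 * trunc_zeta R t m
  else 1.

Section TruncatedZeta.
Variable R : realType.
Implicit Types (s t : seq nat) (n : nat).
Local Notation zs := (trunc_zeta R).

Lemma trunc_zeta_ge0 s n : 0 <= zs s n.
Proof.
elim: s n => //= x t IHt n; apply: sumr_ge0 => m _.
by rewrite mulr_ge0 ?invr_ge0 ?exprn_ge0.
Qed.

Lemma trunc_zeta_chains s n :
  zs s n = \sum_(f <- chains n (size s))
              \prod_(i < size s) ((f i)%:R ^+ nth 0%N s i)^-1.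
Proof.
elim: s n => [|x t IHt] n; first by rewrite /= big_seq1 big_ord0.
rewrite [LHS]/= sum_chains_cons; apply: eq_bigr => m _.
rewrite IHt mulr_sumr; apply: eq_bigr => f _.
rewrite big_ord_recl cons_ffun0; congr (_ * _).
by apply: eq_bigr => i _; rewrite cons_ffunS.
Qed.

Lemma trunc_zeta_recr x t n :
  zs (x :: t) n.+1 = zs (x :: t) n + (n.+1%:R ^+ x)^-1 * zs t n.+1.
Proof. by rewrite /= big_nat_recr. Qed.

Lemma trunc_zeta_homo s : {homo zs s : m n / (m <= n)%N >-> m <= n}.
Proof.
apply: (homo_leq (lexx)) => [y x z|n]; first exact: le_trans.
case: s => [|x t]; first exact: lexx.
by rewrite trunc_zeta_recr lerDl mulr_ge0 ?invr_ge0 ?exprn_ge0 ?trunc_zeta_ge0.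
Qed.

(** By induction the sum is at most the sum of 2/(m(m+1)), which telescopes to
    exactly 2n/(n+1): the bound reproduces itself under a new entry 2, and
    larger entries only decrease the sum. *)
Lemma trunc_zeta_le s n : all (leq 2) s ->
  zs s n.+1 <= 2 * n.+1%:R / n.+2%:R.
Proof.
elim: s n => [|x t IHt] n /=.
  move=> _; rewrite ler_pdivlMr ?ltr0n// mul1r -natrM ler_nat; lia.
move=> /andP[x2 /IHt le_t]; elim: n => [|n IHn].
  rewrite big_nat1 /= expr1n invr1 mul1r; exact: le_t.
rewrite big_nat_recr //=.
have n0 k : (k.+1%:R : R) != 0 by rewrite pnatr_eq0.
have h : 0 < (n.+2%:R : R) by rewrite ltr0n.
apply: (@le_trans _ _ (2 * n.+1%:R / n.+2%:R +
    (n.+2%:R ^+ 2)^-1 * (2 * n.+2%:R / n.+3%:R))); last first.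
  rewrite le_eqVlt; apply/orP; left; apply/eqP.
  have := n0 n.+1; have := n0 n.+2; rewrite -!natr1 => h3 h2.
  by field; rewrite h2 h3.
apply: lerD => //; apply: ler_pM; rewrite ?invr_ge0 ?exprn_ge0 ?trunc_zeta_ge0//.
rewrite lef_pV2 ?posrE ?exprn_gt0//; apply: ler_weXn2l => //.
by rewrite ler1n.
Qed.

Lemma trunc_zeta_le2 s n : all (leq 2) s -> zs s n <= 2.
Proof.
case: n => [_|n /(trunc_zeta_le n) h].
  by case: s => [|x t] /=; rewrite ?big_geq// ler1n.
apply: le_trans h _; rewrite ler_pdivrMr ?ltr0n// ler_pM2l// ler_nat; lia.
Qed.

(** 1/sqrt(n+1) is at most 2 (sqrt(n+1) - sqrt n). *)
Lemma sum_inv_sqrt_le n :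
  \sum_(1 <= m < n.+1) (m%:R)^-1 * Num.sqrt m%:R <= 2 * Num.sqrt n%:R :> R.
Proof.
elim: n => [|n IHn]; first by rewrite big_geq// mulr_ge0// sqrtr_ge0.
rewrite big_nat_recr //=; apply: (le_trans (lerD IHn (lexx _))).
set a : R := Num.sqrt n%:R; set b : R := Num.sqrt n.+1%:R.
have a0 : 0 <= a by exact: sqrtr_ge0.
have b0 : 0 < b by rewrite sqrtr_gt0 ltr0n.
have a2 : a ^+ 2 = n%:R by rewrite sqr_sqrtr.
have b2 : b ^+ 2 = n.+1%:R by rewrite sqr_sqrtr.
have ab : b ^+ 2 = a ^+ 2 + 1 by rewrite a2 b2 natr1.
rewrite -b2 (_ : (b ^+ 2)^-1 * b = 1 / b); last by field; rewrite gt_eqF.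
rewrite -lerBrDl ler_pdivrMr //; nra.
Qed.

(** For b = sqrt(m+1) and a = sqrt m, 1/b^3 is at most 2/a - 2/b. *)
Lemma sum_inv_pow_sqrt_le n :
  \sum_(1 <= m < n.+2) (m%:R ^+ 2)^-1 * Num.sqrt m%:R
    <= 3 - 2 / Num.sqrt n.+1%:R :> R.
Proof.
elim: n => [|n IHn].
  by rewrite big_nat1 expr1n sqrtr1; lra.
rewrite big_nat_recr //=; apply: (le_trans (lerD IHn (lexx _))).
set a : R := Num.sqrt n.+1%:R; set b : R := Num.sqrt n.+2%:R.
have a0 : 0 < a by rewrite sqrtr_gt0 ltr0n.
have b0 : 0 < b by rewrite sqrtr_gt0 ltr0n.
have a2 : a ^+ 2 = n.+1%:R by rewrite sqr_sqrtr.
have b2 : b ^+ 2 = n.+2%:R by rewrite sqr_sqrtr.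
have ab : b ^+ 2 = a ^+ 2 + 1 by rewrite a2 b2 -natr1.
rewrite -b2 -subr_ge0.
rewrite (_ : _ - _ = (2 * b ^+ 3 * (b - a) - a * b) / (a * b ^+ 4)); last first.
  by field; rewrite !gt_eqF.
apply: divr_ge0; last by rewrite mulr_ge0 ?exprn_ge0 ?ltW.
have -> : b - a = (a + b)^-1.
  apply: (mulIf (x := a + b)); first by rewrite gt_eqF// addr_gt0.
  by rewrite mulVf ?gt_eqF ?addr_gt0//; nra.
rewrite subr_ge0 ler_pdivlMr ?addr_gt0//.
have leab : a <= b by nra.
have : a * a * b <= b * b * b by rewrite ler_pM2r// ler_pM// ltW.
have : a * b * b <= b * b * b by rewrite !ler_pM2r.
by rewrite !exprS expr0 mulr1; nra.
Qed.

(** The growth in [n] is only a power of log n.  The square root is a convenient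
    majorant: summing it with weight 1/m reproduces it up to a factor 2, and
    against 1/m^2 it is summable. *)
Lemma trunc_zeta_ones_le d n : zs (nseq d 1%N) n.+1 <= 2 ^+ d * Num.sqrt n.+1%:R.
Proof.
elim: d n => [|d IHd] n /=.
  by rewrite mul1r -[leLHS]sqrtr1 ler_wsqrtr// ler1n.
apply: (@le_trans _ _ (2 ^+ d *
    \sum_(1 <= m < n.+2) m%:R^-1 * Num.sqrt m%:R)); last first.
  by rewrite exprSr -mulrA ler_pM2l ?exprn_gt0//; exact: sum_inv_sqrt_le.
rewrite mulr_sumr; apply: ler_sum_nat => -[//|m] _.
by rewrite expr1 mulrCA ler_pM2l ?invr_gt0 ?ltr0n.
Qed.

Lemma trunc_zeta_two_ones_le d n : zs (2%N :: nseq d 1%N) n <= 3 * 2 ^+ d.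
Proof.
case: n => [|n]; first by rewrite /= big_geq// mulr_ge0// exprn_ge0.
apply: (@le_trans _ _ (2 ^+ d *
    \sum_(1 <= m < n.+2) (m%:R ^+ 2)^-1 * Num.sqrt m%:R)).
  rewrite mulr_sumr; apply: ler_sum_nat => -[//|m] _.
  by rewrite mulrCA ler_pM2l ?invr_gt0 ?exprn_gt0 ?ltr0n ?trunc_zeta_ones_le.
rewrite mulrC ler_pM2r ?exprn_gt0//; apply: le_trans (sum_inv_pow_sqrt_le n) _.
by rewrite gerBl divr_ge0// sqrtr_ge0.
Qed.

(** The finite sums over subsets of [noninc_pos] are cofinal with the truncations,
    so that the two suprema agree. *)
Lemma trunc_zeta_cvg s M : (forall n, zs s n <= M) ->
  tends_to (zs s) (zeta_star R s).
Proof.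
move=> zM; set g := fun f : {ffun 'I_(size s) -> nat} =>
  \prod_(i < size s) ((f i)%:R ^+ nth 0%N s i)^-1 : R.
have g0 f : 0 <= g f by apply: prodr_ge0 => i _; rewrite invr_ge0 exprn_ge0.
have ubz : has_ubound (range (zs s)) by exists M => _ [n _ <-].
have zsup n : zs s n <= sup (range (zs s)) by apply: ub_le_sup => //; exists n.
suff -> : zeta_star R s = sup (range (zs s)).
  by apply: nondecreasing_cvgn => //; exact: trunc_zeta_homo.
have le_sup : (\esum_(f in noninc_pos (size s)) (g f)%:E <=
    (sup (range (zs s)))%:E)%E.
  apply: ge_ereal_sup => _ [X [finX XD] <-].
  rewrite fsbig_finite //= sumEFin lee_fin.
  have [N] := sum_le_chains (fset_set X) g0.
  rewrite -trunc_zeta_chains => h; apply: le_trans (zsup N); apply: le_trans h.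
  rewrite [leRHS]big_mkcond /= big_seq [leRHS]big_seq; apply: ler_sum => f.
  by rewrite in_fset_set// => /set_mem /XD /mem_set ->.
have ge_zs n : ((zs s n)%:E <= \esum_(f in noninc_pos (size s)) (g f)%:E)%E.
  apply: esum_ge; exists [set` [fset f in chains n (size s)]%fset].
    split; first exact: finite_fset.
    by move=> f /=; rewrite inE => /mem_chains[].
  rewrite fsbig_finite //= set_fsetK sumEFin lee_fin.
  by rewrite (sum_fset_seq _ (chains_uniq _ _)) -trunc_zeta_chains.
rewrite /zeta_star -/g; move: le_sup ge_zs.
case: (esum _ _) => [r| |] //=; last by move=> _ /(_ 0%N).
rewrite lee_fin => r1 r2; apply/le_anti; rewrite r1 /=.
by apply: ge_sup; [exists (zs s 0), 0%N|move=> _ [n _ <-]; rewrite -lee_fin].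
Qed.

End TruncatedZeta.

(** * Ratios of binomial coefficients *)

Section BinomialRatio.
Variable K : numFieldType.
Implicit Types (n k l : nat).

(** This is n!^2/((n-k)!(n+k)!), written so that it vanishes for [n < k]. *)
Definition bin_ratio n k : K := 'C(n.*2, n + k)%:R / 'C(n.*2, n)%:R.
Local Notation w := bin_ratio.

Lemma bin_central_neq0 n : 'C(n.*2, n)%:R != 0 :> K.
Proof. by rewrite pnatr_eq0 -lt0n bin_gt0 -addnn leq_addr. Qed.

Lemma bin_ratio0 n : w n 0 = 1.
Proof. by rewrite /w addn0 divff// bin_central_neq0. Qed.

Lemma bin_ratio_small n k : (n < k)%N -> w n k = 0.
Proof. by move=> nk; rewrite /w bin_small ?mul0r// -addnn ltn_add2l. Qed.

Lemma bin_ratioS n k : w n k.+1 * (n%:R + k%:R + 1) = w n k * (n%:R - k%:R).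
Proof.
have [nk|kn] := ltnP n k; first by rewrite !bin_ratio_small ?mul0r// ltnW.
have := mul_bin_left n.*2 (n + k).
rewrite (_ : n.*2 - (n + k) = n - k)%N; last by rewrite -addnn subnDl.
move=> /(congr1 (fun m : nat => m%:R : K)).
rewrite !natrM natrB// -natr1 natrD => e.
rewrite /w addnS mulrAC [RHS]mulrAC; congr (_ / _).
by rewrite mulrC e mulrC.
Qed.

(** By induction on [k] with [bin_ratioS] for [n] and [n.+1].  The step cancels
    [n + k + 1] instead of dividing by [n + 1 - k], and so covers [n < k]. *)
Lemma bin_ratio_recn n k :
  w n.+1 k * (n.+1%:R ^+ 2 - k%:R ^+ 2) = w n k * n.+1%:R ^+ 2.
Proof.
elim: k => [|k IHk]; first by rewrite !bin_ratio0 expr0n subr0.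
have nk0 : n%:R + k%:R + 1 != 0 :> K by rewrite -natrD natr1 pnatr_eq0.
apply: (mulIf nk0).
have e1 := bin_ratioS n k; have e2 := bin_ratioS n.+1 k.
transitivity (w n.+1 k.+1 * (n.+1%:R + k%:R + 1) *
              ((n%:R + k%:R + 1) * (n%:R - k%:R))).
  by rewrite -[k.+1%:R]natr1 -natr1; ring.
rewrite e2 [RHS]mulrAC e1 [RHS]mulrAC -IHk -natr1; ring.
Qed.

Lemma bin_ratio_ge0 n k : 0 <= w n k.
Proof. by rewrite /w divr_ge0. Qed.

Lemma bin_ratio_le1 n k : w n k <= 1.
Proof.
elim: k => [|k IHk]; first by rewrite bin_ratio0.
have [nk|kn] := ltnP n k.+1; first by rewrite bin_ratio_small.
apply: le_trans IHk; have h : 0 < n%:R + k%:R + 1 :> K.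
  by rewrite -natrD natr1 ltr0n.
rewrite -(ler_pM2r h) bin_ratioS; apply: ler_wpM2l; first exact: bin_ratio_ge0.
rewrite -addrA lerD2l; apply: (@le_trans _ _ 0); first by rewrite oppr_le0.
by rewrite addr_ge0.
Qed.

(** The sum telescopes: by [bin_ratioS], 2n (-1)^k w_n(k) is the decrement from
    [k-1] to [k] of (-1)^k w_n(k) (k - n), which vanishes at [k = n]. *)
Lemma bin_ratio_tail n l :
  2 * n%:R * \sum_(l.+1 <= k < n.+1) (-1) ^+ k * w n k =
  (-1) ^+ l * w n l * (l%:R - n%:R).
Proof.
have [nl|ln] := ltnP n l.
  by rewrite big_geq ?mulr0 1?ltnW// bin_ratio_small// mulr0 mul0r.
pose D k := (-1) ^+ k * w n k * (n%:R - k%:R).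
rewrite mulr_sumr [RHS](_ : _ = D n - D l); last first.
  by rewrite /D subrr mulr0 sub0r -mulrN opprB.
rewrite -telescope_sumr// big_add1 /=; apply: eq_bigr => k _.
rewrite /D -[X in _ - X]mulrA -bin_ratioS exprS -[k.+1%:R]natr1; ring.
Qed.

End BinomialRatio.

Lemma tends_to_inv_nat (R : realType) (c : nat) :
  tends_to (fun n => (n + c).+1%:R^-1 : R) 0.
Proof.
apply/tends_toP => e e0; exists (Num.truncn e^-1) => n ln.
rewrite sub0r normrN gtr0_norm ?invr_gt0 ?ltr0n//.
rewrite invf_plt ?posrE ?ltr0n//.
apply: lt_le_trans (truncnS_gt _) _; rewrite ler_nat.
by rewrite ltnS (leq_trans ln)// leq_addr.
Qed.

(** The ratio of the values at [k.+1] and [k] is (n-k)/(n+k+1), which tends to 1. *)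
Lemma bin_ratio_cvg (R : realType) k : tends_to ((bin_ratio R) ^~ k) 1.
Proof.
elim: k => [|k IHk].
  by under eq_fun do rewrite bin_ratio0; exact: tends_to_cst.
(* (n - k)/(n + k + 1) = 1 - (2k + 1)/(n + k + 1) *)
have -> : (bin_ratio R) ^~ k.+1 =
    fun n => bin_ratio R n k * (1 + (- (k.*2.+1)%:R) * (n + k).+1%:R^-1).
  apply/funext => n; have h : (n + k).+1%:R != 0 :> R by rewrite pnatr_eq0.
  apply: (mulIf h); rewrite -[in LHS]natr1 natrD bin_ratioS.
  rewrite -[RHS]mulrA; congr (_ * _).
  rewrite mulrDl -mulrA mulVf// mul1r mulr1 -!natr1 -addnn !natrD; ring.
rewrite -[1 in X in tends_to _ X](_ : 1 * (1 + - (k.*2.+1)%:R * 0) = 1).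
  apply: tends_toM => //; apply: tends_toD; first exact: tends_to_cst.
  by apply: tends_toM; [exact: tends_to_cst|exact: tends_to_inv_nat].
by rewrite mulr0 addr0 mulr1.
Qed.

(** * Finite right-hand sides and their recursion *)

Section FiniteRightSide.
Variable K : numFieldType.

Definition tail_arg d (z : 'I_d.+1 -> K) (i : 'I_d) : K := z (lift ord0 i).

(** The part of the right-hand side over k_1 >= ... >= k_d when k_0 = k is held
    fixed; the base value carries the factor k_d^2 of the last index. *)
Fixpoint inner_sum (d : nat) : ('I_d -> K) -> nat -> K :=
  match d with
  | 0 => fun _ k => k%:R ^+ 2
  | d'.+1 => fun z k =>
      \sum_(1 <= l < k.+1) 2 ^+ Delta k l / (l%:R * (l%:R ^+ 2 - z ord0 ^+ 2)) *
        inner_sum (tail_arg z) l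
  end.

Definition finite_rhs d (z : 'I_d.+1 -> K) n : K :=
  - 2 * \sum_(1 <= k < n.+1) bin_ratio K n k *
          ((-1) ^+ k / (k%:R ^+ 2 - z ord0 ^+ 2) * inner_sum (tail_arg z) k).

(** For d = 0 the series with numerator k_0^2 does not converge absolutely; this
    is its form after splitting k^2/(k^2 - z^2) = 1 + z^2/(k^2 - z^2). *)
Definition finite_rhs0 (z : K) n : K :=
  1 - 2 * z ^+ 2 * \sum_(1 <= k < n.+1) bin_ratio K n k *
                      ((-1) ^+ k / (k%:R ^+ 2 - z ^+ 2)).

Definition off_poles (z : K) := forall k, (0 < k)%N -> k%:R ^+ 2 - z ^+ 2 != 0.

Lemma norm_lt1_off_poles z : `|z| < 1 -> off_poles z.
Proof.
move=> z1 k k0; rewrite subr_eq0; apply/negP => /eqP /(congr1 Num.norm).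
rewrite !normrX normr_nat => e.
have : `|z| ^+ 2 < 1 by rewrite exprn_ilt1.
by rewrite -e -natrX ltrn1 ltnS leqn0 expn_eq0 eqn0Ngt k0.
Qed.

(** After exchanging the two sums, the coefficient of [h l] is
    (-1)^l w(l) + 2 times the alternating tail beyond [l], which
    [bin_ratio_tail] evaluates to l/(n+1) (-1)^l w(l). *)
Lemma alternating_sum_swap n (h : nat -> K) :
  \sum_(1 <= k < n.+2) bin_ratio K n.+1 k * ((-1) ^+ k *
      \sum_(1 <= l < k.+1) 2 ^+ Delta k l * h l) =
  n.+1%:R^-1 * \sum_(1 <= l < n.+2) bin_ratio K n.+1 l * ((-1) ^+ l * (l%:R * h l)).
Proof.
have n0 : n.+1%:R != 0 :> K by rewrite pnatr_eq0.
have inner k : (0 < k)%N -> (k < n.+2)%N ->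
    \sum_(1 <= l < k.+1) 2 ^+ Delta k l * h l =
    h k + 2 * \sum_(1 <= l < n.+2 | (l < k)%N) h l.
  move=> k0 kn; rewrite big_nat_recr //= /Delta eqxx mul1r addrC; congr (_ + _).
  rewrite (big_nat_widen 1 k n.+2); last exact: ltnW.
  rewrite mulr_sumr.
  by apply: eq_bigr => l lk; rewrite gtn_eqF.
transitivity (\sum_(1 <= k < n.+2) (bin_ratio K n.+1 k * (-1) ^+ k * h k +
    \sum_(1 <= l < n.+2 | (l < k)%N) 2 * ((-1) ^+ k * bin_ratio K n.+1 k) * h l)).
  apply: eq_big_nat => k /andP[k1 kn]; rewrite inner // !mulrDr; congr (_ + _).
    by rewrite mulrA.
  by rewrite !mulr_sumr; apply: eq_bigr => l _; ring.
rewrite big_split /= (exchange_big_dep_nat xpredT) //= -big_split /= mulr_sumr.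
apply: eq_big_nat => l /andP[l1 ln].
rewrite -mulr_suml -mulr_sumr -(big_nat_widenl l.+1 1 n.+2 xpredT) //.
have := bin_ratio_tail K n.+1 l; set S := \sum_(_ <= _ < _) _ => e.
apply: (mulfI n0); rewrite [RHS]mulrA mulfV// mul1r.
transitivity (n.+1%:R * (bin_ratio K n.+1 l * (-1) ^+ l * h l) +
              2 * n.+1%:R * S * h l); first by ring.
by rewrite e; ring.
Qed.

Lemma bin_ratio_recn_div n k :
  bin_ratio K n k = bin_ratio K n.+1 k * (n.+1%:R ^+ 2 - k%:R ^+ 2) / n.+1%:R ^+ 2.
Proof. by rewrite bin_ratio_recn mulfK// expf_neq0// pnatr_eq0. Qed.

(** Replacing w_n(k) by w_(n+1)(k) ((n+1)^2 - k^2)/(n+1)^2 turns the coefficient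
    of each term into (k^2 - z^2)/(n+1)^2, which cancels the pole. *)
Lemma bin_ratio_sum_step n (z : K) (f : nat -> K) : off_poles z ->
  let G m := \sum_(1 <= k < m.+1)
               bin_ratio K m k * ((-1) ^+ k / (k%:R ^+ 2 - z ^+ 2) * f k) in
  G n.+1 = G n + z ^+ 2 / n.+1%:R ^+ 2 * G n.+1 +
    (n.+1%:R ^+ 2)^-1 * \sum_(1 <= k < n.+2) bin_ratio K n.+1 k * ((-1) ^+ k * f k).
Proof.
move=> zP G; have n0 : n.+1%:R != 0 :> K by rewrite pnatr_eq0.
have -> : G n = \sum_(1 <= k < n.+2)
               bin_ratio K n k * ((-1) ^+ k / (k%:R ^+ 2 - z ^+ 2) * f k).
  by rewrite [RHS]big_nat_recr //= (bin_ratio_small _ (ltnSn n)) mul0r addr0.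
rewrite /G !mulr_sumr -!big_split /=; apply: eq_big_nat => k /andP[k1 _].
rewrite (bin_ratio_recn_div n k); have := zP k k1 => kz.
by move: (n.+1%:R) n0 => N n0; field; rewrite kz n0.
Qed.

(** [bin_ratio_sum_step] removes the pole at z_0; the factor [l] produced by
    [alternating_sum_swap] then turns the summand of the inner sum into that of
    [finite_rhs] with one variable less. *)
Lemma finite_rhs_rec d (z : 'I_d.+2 -> K) n : (forall i, off_poles (z i)) ->
  finite_rhs z n.+1 = finite_rhs z n +
    z ord0 ^+ 2 / n.+1%:R ^+ 2 * finite_rhs z n.+1 +
    (n.+1%:R ^+ 3)^-1 * finite_rhs (tail_arg z) n.+1.
Proof.
move=> zP; have n0 : n.+1%:R != 0 :> K by rewrite pnatr_eq0.
rewrite {1}/finite_rhs (bin_ratio_sum_step _ _ (zP ord0)) /=.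
pose h l := (l%:R * (l%:R ^+ 2 - tail_arg z ord0 ^+ 2))^-1 *
  inner_sum (tail_arg (tail_arg z)) l.
under [X in _^-1 * X]eq_bigr => k _.
  under eq_bigr do rewrite -mulrA -/(h _).
  over.
rewrite alternating_sum_swap /finite_rhs.
rewrite [X in _ = _ + _ * (_ * X)](_ : _ = \sum_(1 <= l < n.+2)
    bin_ratio K n.+1 l * ((-1) ^+ l * (l%:R * h l))); first by field.
apply: eq_big_nat => l /andP[l1 _]; congr (_ * _); rewrite -!mulrA; congr (_ * _).
have l0 : l%:R != 0 :> K by rewrite pnatr_eq0 -lt0n.
have := zP (lift ord0 ord0) l l1; rewrite /h /tail_arg => lz.
by field; rewrite lz l0.
Qed.

(** The case [l = 0] of [bin_ratio_tail]. *)
Lemma alternating_bin_ratio_sum n :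
  2 * \sum_(1 <= k < n.+2) bin_ratio K n.+1 k * (-1) ^+ k = -1.
Proof.
have n0 : n.+1%:R != 0 :> K by rewrite pnatr_eq0.
apply: (mulIf n0); rewrite mulrAC.
under eq_bigr do rewrite mulrC.
by rewrite bin_ratio_tail bin_ratio0 expr0 mul1r mul1r sub0r mulN1r.
Qed.

Lemma finite_rhs0_rec z n : off_poles z ->
  finite_rhs0 z n.+1 = finite_rhs0 z n + z ^+ 2 / n.+1%:R ^+ 2 * finite_rhs0 z n.+1.
Proof.
move=> zP; have n0 : n.+1%:R != 0 :> K by rewrite pnatr_eq0.
have := bin_ratio_sum_step n (fun=> 1) zP => /=.
have drop1 m (F : nat -> K) : \sum_(1 <= k < m) bin_ratio K m.-1 k * (F k * 1) =
    \sum_(1 <= k < m) bin_ratio K m.-1 k * F k.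
  by apply: eq_bigr => k _; rewrite mulr1.
rewrite (drop1 n.+2) (drop1 n.+1) (drop1 n.+2 (fun k => (-1) ^+ k)) /finite_rhs0.
set S := \sum_(_ <= _ < _) _; set S' := \sum_(_ <= _ < _) _.
set A := \sum_(_ <= _ < _) _ => e.
have -> : S' = S - z ^+ 2 / n.+1%:R ^+ 2 * S - (n.+1%:R ^+ 2)^-1 * A.
  by rewrite {1}e; ring.
have -> : A = -1 / 2 by rewrite -(alternating_bin_ratio_sum n) -/A; field.
by field.
Qed.

Lemma finite_rhs_dim1 (z : 'I_1 -> K) n : off_poles (z ord0) ->
  finite_rhs z n.+1 = finite_rhs0 (z ord0) n.+1.
Proof.
move=> zP; rewrite /finite_rhs /finite_rhs0 /=.
have := alternating_bin_ratio_sum n; set A := \sum_(_ <= _ < _) _ => e.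
transitivity (- 2 * (A + z ord0 ^+ 2 * \sum_(1 <= k < n.+2)
    bin_ratio K n.+1 k * ((-1) ^+ k / (k%:R ^+ 2 - z ord0 ^+ 2)))).
  congr (_ * _); rewrite mulr_sumr -big_split /=.
  apply: eq_big_nat => k /andP[k1 _]; have kz := zP k k1.
  by field.
by rewrite mulrDr mulNr e; ring.
Qed.

End FiniteRightSide.

(** * Truncated generating functions *)

Lemma geometric_sum_le (R : realType) (y : R) n : 0 <= y -> y < 1 ->
  \sum_(i < n) y ^+ i <= (1 - y)^-1.
Proof.
move=> y0 y1; have h : 0 < 1 - y by rewrite subr_gt0.
rewrite -[leRHS]mul1r ler_pdivlMr // mulrC.
have := subrX1 y n; set S := \sum_(_ < _) _ => e.
have : 0 <= y ^+ n by rewrite exprn_ge0.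
have -> : (1 - y) * S = 1 - y ^+ n by rewrite -opprB mulNr -e opprB.
by rewrite gerBl.
Qed.

(** A finite set of exponents lies in a cube, over which the sum factors into
    finite geometric sums. *)
Lemma bounded_sums_geometric (R : realType) d (y : 'I_d -> R) :
  (forall j, 0 <= y j) -> (forall j, y j < 1) ->
  bounded_sums (fun a : {ffun 'I_d -> nat} => \prod_j y j ^+ a j).
Proof.
move=> y0 y1; exists (\prod_j (1 - y j)^-1) => A.
pose N := (\sum_(f <- A) \sum_i f i)%N.
pose emb (h : {ffun 'I_d -> 'I_N.+1}) : {ffun 'I_d -> nat} := [ffun i => val (h i)].
have g0 (a : {ffun 'I_d -> nat}) : 0 <= \prod_j y j ^+ a j.
  by apply: prodr_ge0 => j _; rewrite exprn_ge0.
have emb_inj : injective emb.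
  move=> g h /ffunP e; apply/ffunP => i; apply: val_inj.
  by have := e i; rewrite !ffunE.
have Asub : (A `<=` [fset emb h | h in {: {ffun 'I_d -> 'I_N.+1}}])%fset.
  apply/fsubsetP => f fA; apply/imfsetP.
  have fN i : (f i < N.+1)%N.
    by rewrite ltnS /N (big_fsetD1 f fA) /= (bigD1 i) //= -addnA leq_addr.
  exists [ffun i => Ordinal (fN i)] => //.
  by apply/ffunP => i; rewrite !ffunE.
apply: (@le_trans _ _ (\sum_(h : {ffun 'I_d -> 'I_N.+1}) \prod_j y j ^+ h j)).
  rewrite (_ : \sum_h _ = \sum_(f <- [fset emb h | h in {: {ffun 'I_d -> 'I_N.+1}}]%fset)
      \prod_j y j ^+ f j).
    by rewrite (sum_fset_subset _ Asub) lerDl; apply: sumr_ge0.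
  rewrite big_imfset /=; last by move=> g h _ _; exact: emb_inj.
  rewrite big_enum /=; apply: eq_bigr => h _.
  by apply: eq_bigr => j _; rewrite ffunE.
rewrite -(bigA_distr_bigA (fun j (i : 'I_N.+1) => y j ^+ i)).
apply: ler_prod => j _; rewrite geometric_sum_le //.
by rewrite sumr_ge0// => i _; rewrite exprn_ge0.
Qed.

Definition shift_ffun d (a : {ffun 'I_d.+1 -> nat}) : {ffun 'I_d.+1 -> nat} :=
  cons_ffun (a ord0).+1 (tail_ffun a).

Definition unshift_ffun d (a : {ffun 'I_d.+1 -> nat}) : {ffun 'I_d.+1 -> nat} :=
  cons_ffun (a ord0).-1 (tail_ffun a).

Lemma shift_ffunK d : cancel (@shift_ffun d) (@unshift_ffun d).
Proof.
move=> a; rewrite /unshift_ffun /shift_ffun cons_ffun0 cons_ffunK.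
exact: cons_tail_ffun.
Qed.

Lemma index23_cons0 d (a : {ffun 'I_d.+1 -> nat}) :
  index23 (cons_ffun 0 a) = 3%N :: index23 a.
Proof.
rewrite /index23 cons_ffun0 /= enum_ordSl /= cons_ffunS -map_comp.
by congr (_ :: _ ++ flatten _); apply: eq_map => i /=; rewrite cons_ffunS.
Qed.

Lemma index23_consS d m (a : {ffun 'I_d -> nat}) :
  index23 (cons_ffun m.+1 a) = 2%N :: index23 (cons_ffun m a).
Proof.
rewrite /index23 !cons_ffun0 /=; congr (_ :: _ ++ flatten _).
by apply: eq_map => i /=; rewrite !cons_ffunS.
Qed.

Lemma index23_dim1 (a : {ffun 'I_1 -> nat}) : index23 a = nseq (a ord0) 2%N.
Proof. by rewrite /index23 enum_ord0 /= cats0. Qed.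

Lemma index23_ge2 d (a : {ffun 'I_d.+1 -> nat}) : all (leq 2) (index23 a).
Proof.
apply/allP => x; rewrite mem_cat => /orP[/nseqP[-> //]|].
case/flattenP => _ /mapP[i _ ->].
by rewrite inE => /orP[/eqP -> //|/nseqP[-> //]].
Qed.

Section TruncatedGeneratingFunction.
Variable R : realType.

Definition trunc_lhs d (z : 'I_d.+1 -> R[i]) n (a : {ffun 'I_d.+1 -> nat}) : R[i] :=
  (trunc_zeta R (index23 a) n)%:C * \prod_(j < d.+1) z j ^+ (2 * a j).

Lemma prod_cons_ffun d (z : 'I_d.+1 -> R[i]) m (a : {ffun 'I_d -> nat}) :
  \prod_(j < d.+1) z j ^+ (2 * cons_ffun m a j) =
  z ord0 ^+ (2 * m) * \prod_(j < d) tail_arg z j ^+ (2 * a j).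
Proof.
rewrite big_ord_recl cons_ffun0; congr (_ * _).
by apply: eq_bigr => j _; rewrite cons_ffunS.
Qed.

Lemma trunc_zeta_recr_complex x t n :
  (trunc_zeta R (x :: t) n.+1)%:C = (trunc_zeta R (x :: t) n)%:C +
    (n.+1%:R ^+ x)^-1 * (trunc_zeta R t n.+1)%:C :> R[i].
Proof.
rewrite trunc_zeta_recr.
transitivity ((trunc_zeta R (x :: t) n)%:C +
    ((n.+1%:R ^+ x)^-1)%:C * (trunc_zeta R t n.+1)%:C).
  by rewrite -rmorphM -rmorphD.
by congr (_ + _ * _); rewrite fmorphV rmorphXn /= rmorph_nat.
Qed.

Lemma trunc_lhs_consS d (z : 'I_d.+1 -> R[i]) n m (a : {ffun 'I_d -> nat}) :
  trunc_lhs z n.+1 (cons_ffun m.+1 a) = trunc_lhs z n (cons_ffun m.+1 a) +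
    z ord0 ^+ 2 / n.+1%:R ^+ 2 * trunc_lhs z n.+1 (cons_ffun m a).
Proof.
rewrite /trunc_lhs index23_consS trunc_zeta_recr_complex !prod_cons_ffun.
by rewrite mulnS exprD; ring.
Qed.

Lemma trunc_lhs_cons0 d (z : 'I_d.+2 -> R[i]) n (a : {ffun 'I_d.+1 -> nat}) :
  trunc_lhs z n.+1 (cons_ffun 0 a) = trunc_lhs z n (cons_ffun 0 a) +
    (n.+1%:R ^+ 3)^-1 * trunc_lhs (tail_arg z) n.+1 a.
Proof.
rewrite /trunc_lhs index23_cons0 trunc_zeta_recr_complex !prod_cons_ffun.
by rewrite muln0 expr0; ring.
Qed.

(** The norm of [R[i]] takes values in [R[i]]; majorants of families have to be
    real. *)
Definition real_norm (z : R[i]) : R := complex.Re `|z|.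

Lemma real_normE z : `|z| = (real_norm z)%:C.
Proof. by rewrite /real_norm normc_def. Qed.

Definition lhs_majorant d (z : 'I_d.+1 -> R[i]) (a : {ffun 'I_d.+1 -> nat}) : R :=
  2 * \prod_(j < d.+1) (real_norm (z j) ^+ 2) ^+ a j.

Lemma real_norm_ge0 z : 0 <= real_norm z.
Proof. by rewrite -lecR -real_normE normr_ge0. Qed.

Lemma lhs_majorant_ge0 d (z : 'I_d.+1 -> R[i]) a : 0 <= lhs_majorant z a.
Proof.
rewrite mulr_ge0// prodr_ge0// => j _.
by rewrite !exprn_ge0// real_norm_ge0.
Qed.

Lemma bounded_lhs_majorant d (z : 'I_d.+1 -> R[i]) :
  (forall j, `|z j| < 1) -> bounded_sums (lhs_majorant z).
Proof.
move=> z1.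
have [||M MP] := @bounded_sums_geometric R d.+1 (fun j => real_norm (z j) ^+ 2).
- by move=> j; rewrite exprn_ge0// real_norm_ge0.
- move=> j; rewrite exprn_ilt1 ?real_norm_ge0//.
  by rewrite -ltcR -real_normE z1.
exists (2 * M) => A; rewrite -mulr_sumr ler_pM2l//; exact: MP.
Qed.

Lemma norm_lhs_le d (z : 'I_d.+1 -> R[i]) (a : {ffun 'I_d.+1 -> nat}) (r : R) :
  0 <= r -> r <= 2 ->
  `|r%:C * \prod_(j < d.+1) z j ^+ (2 * a j)| <= (lhs_majorant z a)%:C.
Proof.
move=> r0 r2; rewrite normrM normc_real (ger0_norm r0).
have -> : (lhs_majorant z a)%:C =
    2%:C * (\prod_(j < d.+1) (real_norm (z j) ^+ 2) ^+ a j)%:C.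
  exact: (rmorphM (real_complex R)).
apply: ler_pM; [by rewrite ler0c|exact: normr_ge0|by rewrite lecR|].
rewrite le_eqVlt; apply/orP; left; apply/eqP.
rewrite normr_prod (rmorph_prod (real_complex R)) /=.
by apply: eq_bigr => j _; rewrite normrX real_normE exprM -!rmorphXn.
Qed.

Lemma trunc_lhs_le d (z : 'I_d.+1 -> R[i]) n a :
  `|trunc_lhs z n a| <= (lhs_majorant z a)%:C.
Proof.
apply: norm_lhs_le; first exact: trunc_zeta_ge0.
exact/trunc_zeta_le2/index23_ge2.
Qed.

Lemma trunc_lhs_summable d (z : 'I_d.+1 -> R[i]) n :
  (forall j, `|z j| < 1) -> exists s, sums_to (trunc_lhs z n) s.
Proof.
move=> z1; apply: (sums_to_dominated (bounded_lhs_majorant z1)) => a.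
exact: trunc_lhs_le.
Qed.

Lemma shift_ffun_eq d (a : {ffun 'I_d.+1 -> nat}) :
  (shift_ffun (unshift_ffun a) == a) = (0 < a ord0)%N.
Proof.
rewrite /unshift_ffun /shift_ffun cons_ffun0 cons_ffunK.
rewrite -[X in _ == X]cons_tail_ffun; case: (a ord0) => [|m] /=; last by rewrite eqxx.
apply/negP => /eqP /ffunP /(_ ord0); rewrite !cons_ffun0; lia.
Qed.

Lemma cons0_tail_eq d (a : {ffun 'I_d.+1 -> nat}) :
  (cons_ffun 0 (tail_ffun a) == a) = (a ord0 == 0)%N.
Proof.
rewrite -[X in _ == X]cons_tail_ffun; case: (a ord0) => [|m] /=; first by rewrite eqxx.
by apply/negP => /eqP /ffunP /(_ ord0); rewrite !cons_ffun0.
Qed.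

(** The recursions determine F_(n+1) and G_(n+1) because this factor can be
    cancelled. *)
Lemma one_sub_div_neq0 (z : R[i]) n : `|z| < 1 -> 1 - z ^+ 2 / n.+1%:R ^+ 2 != 0.
Proof.
move=> z1; have n0 : n.+1%:R ^+ 2 != 0 :> R[i] by rewrite expf_neq0// pnatr_eq0.
apply: contra (norm_lt1_off_poles z1 (ltn0Sn n)) => /eqP c0.
by rewrite -[X in X - _]mul1r -(divfK n0 (z ^+ 2)) -mulrBl c0 mul0r.
Qed.

(** F_n for d = 0: the coefficient family of F_(n+1) is that of F_n plus
    z^2/(n+1)^2 times its own shift by one copy of 2, and F_0 = G_0 = 1. *)
Lemma sums_to_trunc_lhs_dim1 (z : 'I_1 -> R[i]) n s : `|z ord0| < 1 ->
  sums_to (trunc_lhs z n) s -> s = finite_rhs0 (z ord0) n.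
Proof.
move=> z1; have zP := norm_lt1_off_poles z1.
elim: n s => [|n IHn] s hs.
  have -> : finite_rhs0 (z ord0) 0 = 1.
    by rewrite /finite_rhs0 big_geq ?mulr0 ?subr0.
  apply: (sums_to_unique hs).
  pose o : {ffun 'I_1 -> nat} := [ffun=> 0%N].
  have -> : 1 = \sum_(a <- [fset o]%fset) trunc_lhs z 0 a.
    by rewrite big_seq_fset1 /trunc_lhs index23_dim1 big_ord1 !ffunE mul1r.
  apply: sums_to_finite => a; rewrite inE /trunc_lhs index23_dim1 => ao.
  case e : (a ord0) => [|m] /=; last by rewrite big_geq// mul0r.
  by case/eqP: ao; apply/ffunP => i; rewrite ord1 e ffunE.
have [|t ht] := @trunc_lhs_summable 0 z n; first by move=> j; rewrite ord1.
have hshift := sums_toZ (c := z ord0 ^+ 2 / n.+1%:R ^+ 2)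
  (sums_to_reindex (@shift_ffunK 0) hs).
have := sums_toD ht hshift; rewrite (_ : (fun=> _) = trunc_lhs z n.+1).
  move=> /(sums_to_unique hs) e; move: (IHn _ ht) => {}ht.
  have := finite_rhs0_rec n zP; rewrite -ht.
  move=> e'; apply: (mulIf (one_sub_div_neq0 n z1)).
  by rewrite !mulrBr !mulr1 {1}e {1}e'; ring.
apply/funext => a; rewrite -(cons_tail_ffun a).
move: (a ord0) (tail_ffun a) => m b.
rewrite shift_ffun_eq /unshift_ffun cons_ffun0 cons_ffunK.
case: m => [|m] /=; last by rewrite trunc_lhs_consS.
rewrite mulr0 addr0 /trunc_lhs index23_dim1 cons_ffun0.
by congr (_ * _).
Qed.

(** An outer induction on [d] provides the contribution of the arguments that
    start with 3, whose tail has one variable less.  For [d = 0] the two forms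
    of the right-hand side agree only for [n > 0], as F_0 = 1 but the sum over
    k_0 is empty. *)
Lemma sums_to_trunc_lhs d (z : 'I_d.+1 -> R[i]) n s : (0 < n + d)%N ->
  (forall j, `|z j| < 1) -> sums_to (trunc_lhs z n) s -> s = finite_rhs z n.
Proof.
elim: d z n s => [|d IHd] z n s nd z1 hs.
  case: n nd hs => // n _ hs; rewrite finite_rhs_dim1.
    exact: sums_to_trunc_lhs_dim1.
  exact: norm_lt1_off_poles.
have zP i : off_poles (z i) by exact: norm_lt1_off_poles.
elim: n s {nd} hs => [|n IHn] s hs.
  have -> : finite_rhs z 0 = 0 by rewrite /finite_rhs big_geq ?mulr0.
  apply: (sums_to_unique hs).
  rewrite (_ : trunc_lhs z 0 = fun=> 0); first exact: sums_to0.
  apply/funext => a; rewrite -(cons_tail_ffun a) /trunc_lhs.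
  case: (a ord0) => [|m]; rewrite ?index23_consS ?index23_cons0 /=;
    by rewrite big_geq// mul0r.
have [t ht] := trunc_lhs_summable n z1.
have z1' j : `|tail_arg z j| < 1 by exact: z1.
have [u hu] := trunc_lhs_summable n.+1 z1'.
have hshift := sums_toZ (c := z ord0 ^+ 2 / n.+1%:R ^+ 2)
  (sums_to_reindex (@shift_ffunK d.+1) hs).
have hcons := sums_toZ (c := (n.+1%:R ^+ 3)^-1) (sums_to_reindex (@cons_ffunK d.+1 0) hu).
have := sums_toD (sums_toD ht hshift) hcons.
rewrite (_ : (fun=> _) = trunc_lhs z n.+1).
  move=> /(sums_to_unique hs) e; have := finite_rhs_rec n zP.
  rewrite -(IHn _ ht) -(IHd _ n.+1 _ isT z1' hu) => e'.
  apply: (mulIf (one_sub_div_neq0 n (z1 ord0))).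
  by rewrite !mulrBr !mulr1 {1}e {1}e'; ring.
apply/funext => a; rewrite -(cons_tail_ffun a).
move: (a ord0) (tail_ffun a) => m b.
rewrite shift_ffun_eq cons0_tail_eq /unshift_ffun cons_ffun0 cons_ffunK.
case: m => [|m] /=; last by rewrite trunc_lhs_consS mulr0 addr0.
by rewrite mulr0 addr0 trunc_lhs_cons0.
Qed.

End TruncatedGeneratingFunction.

(** * Passage to the limit *)

Section RightSide.
Variable R : realType.

(** The factors of [rhs_term] that involve k_1, ..., k_d, together with k_d^2;
    [cons_ffun k f] supplies k_0 = k for the first [Delta]. *)
Definition chain_weight (K : numFieldType) d (z : 'I_d -> K) k
    (f : {ffun 'I_d -> nat}) : K :=
  (cons_ffun k f ord_max)%:R ^+ 2 *
  \prod_(i < d) (2 ^+ Delta (cons_ffun k f (widen_ord (leqnSn d) i)) (f i) /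
                 ((f i)%:R * ((f i)%:R ^+ 2 - z i ^+ 2))).

Lemma inner_sum_chains (K : numFieldType) d (z : 'I_d -> K) k :
  inner_sum z k = \sum_(f <- chains k d) chain_weight z k f.
Proof.
elim: d z k => [|d IHd] z k.
  rewrite /= big_seq1 /chain_weight big_ord0 mulr1.
  by rewrite (_ : ord_max = ord0) ?cons_ffun0//; exact: val_inj.
rewrite [LHS]/= sum_chains_cons; apply: eq_bigr => l _.
rewrite IHd mulr_sumr; apply: eq_bigr => f _.
rewrite /chain_weight big_ord_recl cons_ffun0.
rewrite (_ : ord_max = lift ord0 ord_max); last exact: val_inj.
rewrite cons_ffunS (_ : widen_ord _ ord0 = ord0); last exact: val_inj.
rewrite cons_ffun0 mulrCA; congr (_ * (_ * _)).
apply: eq_bigr => i _; rewrite !cons_ffunS; congr (2 ^+ Delta _ _ / _).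
rewrite (_ : widen_ord _ (lift ord0 i) = lift ord0 (widen_ord (leqnSn d) i)).
  by rewrite cons_ffunS.
exact: val_inj.
Qed.

Lemma rhs_term_cons d (z : 'I_d.+1 -> R[i]) k (f : {ffun 'I_d -> nat}) :
  rhs_term z (cons_ffun k f) =
  (-1) ^+ k / (k%:R ^+ 2 - z ord0 ^+ 2) * chain_weight (tail_arg z) k f.
Proof.
rewrite /rhs_term /chain_weight cons_ffun0 [RHS]mulrA.
congr (_ * _); first by rewrite mulrAC.
by apply: eq_bigr => i _; rewrite !cons_ffunS.
Qed.

Lemma finite_rhs_chains d (z : 'I_d.+1 -> R[i]) n :
  finite_rhs z n =
  - 2 * \sum_(f <- chains n d.+1) bin_ratio R[i] n (f ord0) * rhs_term z f.
Proof.
rewrite sum_chains_cons /finite_rhs; congr (_ * _); apply: eq_bigr => k _.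
rewrite inner_sum_chains !mulr_sumr; apply: eq_bigr => f _.
by rewrite cons_ffun0 rhs_term_cons.
Qed.

(** |k^2 - z^2| >= k^2 - |z|^2 >= (1 - |z|^2) k^2 as k >= 1. *)
Lemma norm_inv_pole_le (z : R[i]) k : `|z| < 1 -> (0 < k)%N ->
  `|(k%:R ^+ 2 - z ^+ 2)^-1| <= (1 - `|z| ^+ 2)^-1 * (k%:R ^+ 2)^-1.
Proof.
move=> z1 k0; have c0 : 0 < 1 - `|z| ^+ 2 by rewrite subr_gt0 exprn_ilt1.
have k20 : 0 < k%:R ^+ 2 :> R[i] by rewrite exprn_gt0 ?ltr0n.
have p0 := norm_lt1_off_poles z1 k0.
rewrite normfV -invfM lef_pV2 ?posrE ?normr_gt0 ?(mulr_gt0 c0 k20)//.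
apply: le_trans (lerB_dist _ _).
rewrite !normrX normr_nat mulrBl mul1r lerD2l lerN2.
by apply: ler_peMr; rewrite ?exprn_ge0// exprn_ege1// ler1n.
Qed.

Definition rhs_const d (z : 'I_d.+1 -> R[i]) : R[i] :=
  (1 - `|z ord0| ^+ 2)^-1 * \prod_(i < d) (2 * (1 - `|z (lift ord0 i)| ^+ 2)^-1).

Lemma rhs_const_gt0 d (z : 'I_d.+1 -> R[i]) :
  (forall j, `|z j| < 1) -> 0 < rhs_const z.
Proof.
move=> z1; have c0 j : 0 < 1 - `|z j| ^+ 2 by rewrite subr_gt0 exprn_ilt1.
by rewrite mulr_gt0 ?invr_gt0// prodr_gt0// => i _; rewrite mulr_gt0 ?invr_gt0.
Qed.

(** The summand of the zeta star value at (2, 1, ..., 1). *)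
Definition ones_weight d (k : {ffun 'I_d.+1 -> nat}) : R :=
  \prod_(i < d.+1) ((k i)%:R ^+ nth 0%N (2%N :: nseq d 1%N) i)^-1.

Lemma ones_weight_ge0 d (k : {ffun 'I_d.+1 -> nat}) : 0 <= ones_weight k.
Proof. by apply: prodr_ge0 => i _; rewrite invr_ge0 exprn_ge0. Qed.

Lemma ones_weightE d (k : {ffun 'I_d.+1 -> nat}) :
  (ones_weight k)%:C =
  ((k ord0)%:R ^+ 2)^-1 * \prod_(i < d) ((k (lift ord0 i))%:R)^-1.
Proof.
rewrite (rmorph_prod (real_complex R)) big_ord_recl /=; congr (_ * _).
  by rewrite fmorphV rmorphXn /= rmorph_nat.
apply: eq_bigr => i _; rewrite nth_nseq ltn_ord expr1.
by rewrite fmorphV /= rmorph_nat.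
Qed.

(** Each inner factor is O(1/k_i^3) and the outer one O(1/k_0^2).  The squared
    last index in the numerator is absorbed by the product of the 1/k_i^2 over
    i >= 1, which is nonempty for at least two variables; 1/k_0^2 times the
    product of the 1/k_i is left. *)
Lemma rhs_term_le d (z : 'I_d.+2 -> R[i]) (k : {ffun 'I_d.+2 -> nat}) :
  (forall j, `|z j| < 1) -> noninc_pos d.+2 k ->
  `|rhs_term z k| <= rhs_const z * (ones_weight k)%:C.
Proof.
move=> z1 [k1 _]; have c0 j : 0 < 1 - `|z j| ^+ 2 by rewrite subr_gt0 exprn_ilt1.
have k0 j : 0 < (k j)%:R :> R[i] by rewrite ltr0n.
rewrite ones_weightE /rhs_term !normrM normr_prod normrX normrN1 expr1n mul1r.
rewrite normr_nat -expr2.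
pose u i : R[i] := 2 * (1 - `|z (lift ord0 i)| ^+ 2)^-1 *
  ((k (lift ord0 i))%:R)^-1 * ((k (lift ord0 i))%:R ^+ 2)^-1.
have fac (i : 'I_d.+1) :
    `|2 ^+ Delta (k (widen_ord (leqnSn d.+1) i)) (k (lift ord0 i)) /
      ((k (lift ord0 i))%:R * ((k (lift ord0 i))%:R ^+ 2 - z (lift ord0 i) ^+ 2))|
    <= u i.
  have nk : `|(k (lift ord0 i))%:R^-1 : R[i]| = (k (lift ord0 i))%:R^-1.
    by rewrite normfV normr_nat.
  rewrite /u invfM 2!normrM nk normrX normr_nat -!mulrA; apply: ler_pM.
  - by rewrite exprn_ge0.
  - by rewrite mulr_ge0 ?normr_ge0// invr_ge0.
  - by rewrite /Delta; case: ifP => _; rewrite ?expr0 ?expr1 ?ler1n.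
  rewrite mulrCA ler_pM2l ?invr_gt0//; exact: norm_inv_pole_le.
apply: (@le_trans _ _ ((k ord_max)%:R ^+ 2 *
    ((1 - `|z ord0| ^+ 2)^-1 * ((k ord0)%:R ^+ 2)^-1) * \prod_(i < d.+1) u i)).
  apply: ler_pM.
  - by rewrite mulr_ge0 ?exprn_ge0 ?normr_ge0.
  - by apply: prodr_ge0 => i _; rewrite normr_ge0.
  - by rewrite ler_pM2l ?exprn_gt0// norm_inv_pole_le.
  by apply: ler_prod => i _; rewrite normr_ge0 fac.
rewrite /u !big_split /= /rhs_const !big_split /=.
set c := (1 - _)^-1; set P2 := \prod_(i < d.+1) 2; set Pc := \prod_(i < d.+1) (1 - _)^-1.
set P1 := \prod_(i < d.+1) _^-1; set P3 := \prod_(i < d.+1) _^-1.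
rewrite (_ : _ * _ * _ = (c * (P2 * Pc) * (((k ord0)%:R ^+ 2)^-1 * P1)) *
  ((k ord_max)%:R ^+ 2 * P3)); last by ring.
apply: ler_piMr.
  have c'0 : 0 <= c by rewrite invr_ge0 ltW.
  have P20 : 0 <= P2 by apply: prodr_ge0.
  have Pc0 : 0 <= Pc by apply: prodr_ge0 => i _; rewrite invr_ge0 ltW.
  have P10 : 0 <= P1 by apply: prodr_ge0 => i _; rewrite invr_ge0 ltW.
  by rewrite !mulr_ge0// invr_ge0 exprn_ge0// ltW.
rewrite /P3 big_ord_recr /= (_ : lift ord0 ord_max = ord_max); last exact: val_inj.
(* The last factor of [P3] is the inverse of k_d^2. *)
rewrite mulrCA mulfV ?mulr1 ?expf_neq0 ?gt_eqF//.
apply: prodr_ile1 => i _; apply/andP; split.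
  by rewrite invr_ge0 exprn_ge0// ltW.
by rewrite invf_le1 ?exprn_gt0// exprn_ege1// ler1n k1.
Qed.

Lemma bounded_sums_ones_weight d :
  bounded_sums (fun k : {ffun 'I_d.+1 -> nat} =>
    if k \in noninc_pos d.+1 then ones_weight k else 0).
Proof.
exists (3 * 2 ^+ d) => A; rewrite -big_mkcond /=.
have [N] := sum_le_chains A (@ones_weight_ge0 d); move/le_trans; apply.
apply: le_trans (trunc_zeta_two_ones_le R d N).
by rewrite trunc_zeta_chains /= size_nseq.
Qed.

Lemma bin_ratio_cvg_complex k : tends_to ((bin_ratio R[i]) ^~ k) 1.
Proof.
rewrite (_ : _ ^~ k = fun n => (bin_ratio R n k)%:C).
  have := tends_to_real_complex (@bin_ratio_cvg R k).
  by rewrite (rmorph1 (real_complex R)).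
apply/funext => n; rewrite /bin_ratio.
by rewrite (rmorphM (real_complex R)) fmorphV /= !rmorph_nat.
Qed.

(** The terms weighted by w_n(k_0) are dominated by the unweighted ones, and only
    the finitely many tuples with k_0 <= n contribute to them. *)
Lemma rhs_limit d (z : 'I_d.+2 -> R[i]) : (forall j, `|z j| < 1) ->
  exists2 S, has_sum (noninc_pos d.+2) (rhs_term z) S &
             tends_to (finite_rhs z) (- 2 * S).
Proof.
move=> z1.
have [M M0 rhs_constE] := gt0_real_complex (rhs_const_gt0 z1).
pose D := noninc_pos d.+2.
pose b k := if k \in D then M * ones_weight k else 0.
pose r n k := if k \in D then bin_ratio R[i] n (k ord0) * rhs_term z k else 0.
have b0 k : 0 <= b k.
  by rewrite /b; case: ifP => // _; rewrite mulr_ge0 ?ones_weight_ge0 ?ltW.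
have bM : bounded_sums b.
  have [N NP] := bounded_sums_ones_weight d.+1; exists (M * N) => A.
  rewrite (eq_bigr (fun k => M * if k \in D then ones_weight k else 0)).
    by rewrite -mulr_sumr ler_pM2l.
  by move=> k _; rewrite /b; case: ifP => //; rewrite mulr0.
have rb n k : `|r n k| <= (b k)%:C.
  rewrite /r /b; case: ifP => [/set_mem kD|_]; last by rewrite normr0.
  rewrite (rmorphM (real_complex R)) /= -rhs_constE normrM.
  apply: le_trans (rhs_term_le z1 kD).
  by rewrite ler_piMl// ger0_norm ?bin_ratio_le1// bin_ratio_ge0.
have rlim k : tends_to (r ^~ k) (if k \in D then rhs_term z k else 0).
  rewrite /r; case: ifP => _; last exact: tends_to_cst.
  rewrite -[X in tends_to _ X]mul1r.
  by apply: tends_toM; [exact: bin_ratio_cvg_complex|exact: tends_to_cst].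
pose s n := \sum_(k <- chains n d.+2) bin_ratio R[i] n (k ord0) * rhs_term z k.
have rs n : sums_to (r n) (s n).
  have -> : s n = \sum_(k <- [fset k in chains n d.+2]%fset) r n k.
    rewrite (sum_fset_seq _ (chains_uniq _ _)) /s big_seq [RHS]big_seq.
    by apply: eq_bigr => k /mem_chains[kD _]; rewrite /r mem_set.
  apply: sums_to_finite => k; rewrite mem_fset_seq /r => kn.
  case: ifP => // /set_mem kD.
  have [nk|kn'] := ltnP n (k ord0); first by rewrite bin_ratio_small// mul0r.
  case/negP: kn; apply/mem_chains; split=> // i.
  by apply: leq_trans kn'; apply: kD.2.
have [S rS sS] := sums_to_tannery b0 bM rb rlim rs.
exists S; first by rewrite has_sumE.
rewrite (_ : finite_rhs z = fun n => - 2 * s n).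
  by apply: tends_toM; [exact: tends_to_cst|exact: sS].
by apply/funext => n; rewrite finite_rhs_chains.
Qed.

Lemma rhs_limit0 (z : R[i]) : `|z| < 1 ->
  exists2 S, has_sum [set k : nat | (1 <= k)%N]
               (fun k => (-1) ^+ k / (k%:R ^+ 2 - z ^+ 2)) S &
             tends_to (finite_rhs0 z) (1 - 2 * z ^+ 2 * S).
Proof.
move=> z1; pose D := [set k : nat | (1 <= k)%N].
have c0 : 0 < (1 - `|z| ^+ 2)^-1 by rewrite invr_gt0 subr_gt0 exprn_ilt1.
have [M M0 cE] := gt0_real_complex c0.
pose g (k : nat) := (-1) ^+ k / (k%:R ^+ 2 - z ^+ 2).
pose b (k : nat) : R := M * (k%:R ^+ 2)^-1.
pose r n k := if k \in D then bin_ratio R[i] n k * g k else 0.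
have b0 k : 0 <= b k.
  by apply: mulr_ge0; [exact: ltW|rewrite invr_ge0 exprn_ge0].
have bM : bounded_sums b.
  exists (M * 2) => A; rewrite -mulr_sumr ler_pM2l//.
  pose N := (\sum_(k <- A) k)%N.
  have AN : (A `<=` [fset k in index_iota 0 N.+1])%fset.
    apply/fsubsetP => k kA; rewrite mem_fset_seq mem_index_iota /=.
    by rewrite ltnS /N (big_fsetD1 k kA) leq_addr.
  apply: (@le_trans _ _ (\sum_(k <- [fset k in index_iota 0 N.+1]%fset) (k%:R ^+ 2)^-1)).
    by rewrite (sum_fset_subset _ AN) lerDl sumr_ge0// => k _; rewrite invr_ge0 exprn_ge0.
  rewrite (sum_fset_seq (r := index_iota 0 N.+1)) ?iota_uniq//.
  rewrite big_nat_recl //= expr0n invr0 add0r.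
  apply: le_trans (trunc_zeta_le2 R (s := [:: 2%N]) N _) => //=.
  by rewrite [leRHS]big_add1 /=; apply: ler_sum => k _; rewrite mulr1.
have rb n k : `|r n k| <= (b k)%:C.
  rewrite /r; case: ifP => [/set_mem k1|_]; last by rewrite normr0 ler0c.
  rewrite /b (rmorphM (real_complex R)) /= -cE fmorphV rmorphXn /= rmorph_nat.
  apply: le_trans (norm_inv_pole_le z1 k1).
  rewrite /g normrM [X in _ * X]normrM normrX normrN1 expr1n mul1r ler_piMl//.
  by rewrite ger0_norm ?bin_ratio_le1// bin_ratio_ge0.
have rlim k : tends_to (r ^~ k) (if k \in D then g k else 0).
  rewrite /r; case: ifP => _; last exact: tends_to_cst.
  rewrite -[X in tends_to _ X]mul1r.
  by apply: tends_toM; [exact: bin_ratio_cvg_complex|exact: tends_to_cst].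
pose s n := \sum_(1 <= k < n.+1) bin_ratio R[i] n k * g k.
have rs n : sums_to (r n) (s n).
  have -> : s n = \sum_(k <- [fset k in index_iota 1 n.+1]%fset) r n k.
    rewrite (sum_fset_seq (r := index_iota 1 n.+1)) ?iota_uniq//.
    apply: eq_big_nat => k /andP[k1 _].
    by rewrite /r mem_set.
  apply: sums_to_finite => k; rewrite mem_fset_seq mem_index_iota /r => kn.
  case: ifP => // /set_mem /= k1; rewrite bin_ratio_small ?mul0r//.
  by move: kn; rewrite k1 /= -ltnNge.
have [S rS sS] := sums_to_tannery b0 bM rb rlim rs.
exists S; first by rewrite has_sumE.
rewrite (_ : finite_rhs0 z = fun n => 1 + - (2 * z ^+ 2) * s n); last first.
  by apply/funext => n; rewrite /finite_rhs0 mulNr.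
rewrite -[_ - _ * S]/(1 + - (2 * z ^+ 2 * S)) -[- (_ * S)]mulNr.
apply: tends_toD; first exact: tends_to_cst.
by apply: tends_toM; [exact: tends_to_cst|exact: sS].
Qed.

(** Stated for an arbitrary sequence [g] of values of the truncated sums, so that
    it applies to both forms of the finite right-hand side. *)
Lemma lhs_limit d (z : 'I_d.+1 -> R[i]) (g : nat -> R[i]) :
  (forall j, `|z j| < 1) ->
  (forall n s, sums_to (trunc_lhs z n) s -> s = g n) ->
  exists2 s, sums_to (lhs_term z) s & tends_to g s.
Proof.
move=> z1 gP.
apply: (@sums_to_tannery R _ (lhs_majorant z) (trunc_lhs z)).
- exact: lhs_majorant_ge0.
- exact: bounded_lhs_majorant.
- exact: trunc_lhs_le.
- move=> a; apply: tends_toM; last exact: tends_to_cst.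
  apply: tends_to_real_complex; apply: (@trunc_zeta_cvg _ _ 2) => n.
  exact/trunc_zeta_le2/index23_ge2.
- by move=> n; have [s hs] := trunc_lhs_summable n z1; rewrite -(gP n s hs).
Qed.

End RightSide.

Theorem theorem1p1 (R : realType) :
  (forall (d : nat) (z : 'I_d.+1 -> R[i]),
     (1 <= d)%N -> (forall j, `|z j| < 1) ->
     exists S : R[i],
       has_sum (noninc_pos d.+1) (rhs_term z) S /\
       has_sum [set: {ffun 'I_d.+1 -> nat}] (lhs_term z) (- 2 * S)) /\
  (forall z0 : R[i], `|z0| < 1 ->
     exists S : R[i],
       has_sum [set k : nat | (1 <= k)%N]
         (fun k => (-1) ^+ k / (k%:R ^+ 2 - z0 ^+ 2)) S /\
       has_sum [set: nat]
         (fun a => (zeta_star R (nseq a 2%N))%:C * z0 ^+ (2 * a))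
         (1 - 2 * z0 ^+ 2 * S)).
Proof.
split=> [[//|d] z _ z1|z0 z1].
  have [S hS limS] := rhs_limit z1; exists S; split; first exact: hS.
  have [|s hs lims] := @lhs_limit R _ z (finite_rhs z) z1.
    by move=> n s; apply: sums_to_trunc_lhs => //; rewrite addnS.
  by rewrite has_sum_setT (tends_to_unique limS lims).
have [S hS limS] := rhs_limit0 z1; exists S; split; first exact: hS.
pose z (i : 'I_1) := z0.
have [|n s|s hs lims] := @lhs_limit R _ z (finite_rhs0 z0).
- by move=> j.
- exact: (sums_to_trunc_lhs_dim1 (z := z)).
rewrite has_sum_setT (tends_to_unique limS lims).
pose e (a : {ffun 'I_1 -> nat}) := a ord0.
pose p (m : nat) : {ffun 'I_1 -> nat} := [ffun=> m].
have eK : cancel e p by move=> a; apply/ffunP => i; rewrite ffunE ord1.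
rewrite (_ : (fun=> _) = fun m => if e (p m) == m then lhs_term z (p m) else 0).
  exact: sums_to_reindex eK hs.
apply/funext => m; rewrite /e /p ffunE eqxx /lhs_term index23_dim1 big_ord1 ffunE.
by [].
Qed.
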